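(* The canonical Möbius structure $M_0$ on $X=S^1$ is convex, that is, it satisfies the Convexity Axiom (C): for all pairwise distinct points $o',x,y,z,o,\omega\in X$ lying in this cyclic order on the circle (in one of the two directions) and any semi-metric $|\cdot\,\cdot|$ from $M_0$, the equality $$\frac{|o'x|\,|yo|}{|xo|\,|o'y|}=\frac{|o'y|\,|zo|}{|yo|\,|o'z|}$$ implies $$\frac{|yo|\,|z\omega|}{|y\omega|\,|zo|}>\frac{|xo|\,|y\omega|}{|x\omega|\,|yo|}.$$
   Context: A semi-metric on $X$ is a symmetric function $d:X^2\to\mathbb R\cup\{\infty\}$, positive off the diagonal, zero on it, with at most one infinitely remote point $\omega_0$, i.e. a point with $d(x,\omega_0)=\infty$ for some (then, by requirement, for all) $x\ne\omega_0$. Two semi-metrics are Möbius equivalent if they have the same cross-ratios $\frac{d(x_1,x_3)d(x_2,x_4)}{d(x_1,x_4)d(x_2,x_3)}$ on all 4-tuples of pairwise distinct points (here and in the homogeneous expressions of the claim, infinite distances cancel). A Möbius structure is a Möbius equivalence class of semi-metrics. The canonical Möbius structure $M_0$ on $S^1=\mathbb R\cup\{\infty\}$ is the class of the standard metric of $\mathbb R$ extended by $|x\infty|=\infty$ for $x\in\mathbb R$; for each $u\in S^1$ its representatives with infinitely remote point $u$ are standard metrics (up to a positive factor) on $S^1\setminus\{u\}\cong\mathbb R$. *)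

(* Defs.v *)
From HB Require Import structures.
From mathcomp Require Import all_boot all_order all_algebra.
From mathcomp Require Import all_classical all_reals all_analysis.
Import Order.TTheory GRing.Theory Num.Theory.
Import numFieldTopology.Exports numFieldNormedType.Exports.

Set Implicit Arguments.
Unset Strict Implicit.
Unset Printing Implicit Defensive.

Local Open Scope classical_set_scope.
Local Open Scope ring_scope.

Definition infinitely_remote (R : realType) (X : eqType) (d : X -> X -> \bar R)
    (w : X) : Prop :=
  forall x, x != w -> d x w = +oo%E.

(* By symmetry d x y = +oo constrains both points, so "d x w = +oo for some x,
   then for all x" has to read: an infinite distance is always due to one of
   its two endpoints being infinitely remote. *)
Record semimetric (R : realType) (X : eqType) := Semimetric {
  semidist :> X -> X -> \bar R;
  semidist_sym : forall x y, semidist x y = semidist y x;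
  semidist_diag : forall x, semidist x x = 0%E;
  semidist_gt0 : forall x y, x != y -> (0 < semidist x y)%E;
  semidist_infty : forall x y, semidist x y = +oo%E ->
    infinitely_remote semidist x \/ infinitely_remote semidist y;
  infinitely_remote_uniq : forall w w',
    infinitely_remote semidist w -> infinitely_remote semidist w' -> w = w'
}.

(* Infinite distances count as the factor 1. In a homogeneous ratio of
   distances between distinct points (each point occurring equally often above
   and below) this is the cancellation of infinite distances. *)
Definition dfactor (R : realType) (X : eqType) (d : semimetric R X) (x y : X)
    : R :=
  if d x y is r%:E then r else 1.

Definition cross_ratio (R : realType) (X : eqType) (d : semimetric R X)
    (x1 x2 x3 x4 : X) : R :=
  (dfactor d x1 x3 * dfactor d x2 x4) / (dfactor d x1 x4 * dfactor d x2 x3).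

Definition mobius_equivalent (R : realType) (X : eqType)
    (d d' : semimetric R X) : Prop :=
  forall x1 x2 x3 x4 : X, uniq [:: x1; x2; x3; x4] ->
    cross_ratio d x1 x2 x3 x4 = cross_ratio d' x1 x2 x3 x4.

Definition mobius_class (R : realType) (X : eqType) (d : semimetric R X)
    : set (semimetric R X) :=
  [set d' | mobius_equivalent d d'].

Record mobius_structure (R : realType) (X : eqType) := MobiusStructure {
  representatives : set (semimetric R X);
  representativesP : exists d, representatives = mobius_class d
}.

(* S^1 = R with a point at infinity, [None]. *)
Notation circle := one_point_compactification.

(* The cyclic order of the circle is the one induced by the linear order of
   ]-oo, +oo], where the point at infinity becomes the largest element. *)
Definition circle_coord (R : realType) (x : circle R) : \bar R :=
  if x is Some r then r%:E else +oo%E.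

Definition positively_ordered (R : realType) (s : seq (circle R)) : Prop :=
  exists k : nat, sorted <%O (rot k (map (@circle_coord R) s)).

Definition cyclically_ordered (R : realType) (s : seq (circle R)) : Prop :=
  positively_ordered s \/ positively_ordered (rev s).

Definition standard_dist (R : realType) (x y : circle R) : \bar R :=
  match x, y with
  | Some a, Some b => `|a - b|%:E
  | None, None => 0%E
  | _, _ => +oo%E
  end.

Section standard_semimetric.
Variable R : realType.
Local Notation d := (@standard_dist R).

Lemma standard_dist_sym (x y : circle R) : d x y = d y x.
Proof. by case: x y => [a|] [b|] //=; rewrite distrC. Qed.

Lemma standard_dist_diag (x : circle R) : d x x = 0%E.
Proof. by case: x => [a|] //=; rewrite subrr normr0. Qed.

Lemma standard_dist_gt0 (x y : circle R) : x != y -> (0 < d x y)%E.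
Proof.
case: x y => [a|] [b|] //= ab; rewrite lte_fin normr_gt0 subr_eq0.
by apply: contra_neq ab => ->.
Qed.

Lemma remote_None : infinitely_remote d (None : circle R).
Proof. by case. Qed.

Lemma remote_standard (w : circle R) : infinitely_remote d w -> w = None.
Proof.
case: w => // a /(_ (Some (a + 1))) /=.
have /[swap]/[apply] // : Some (a + 1) != Some a :> circle R.
apply/eqP => -[] /eqP.
by rewrite -subr_eq0 addrAC subrr add0r oner_eq0.
Qed.

Lemma standard_dist_infty (x y : circle R) :
  d x y = +oo%E -> infinitely_remote d x \/ infinitely_remote d y.
Proof.
by case: x y => [a|] [b|] //= _; [right|left]; exact: remote_None.
Qed.

Lemma standard_remote_uniq (w w' : circle R) :
  infinitely_remote d w -> infinitely_remote d w' -> w = w'.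
Proof. by move=> /remote_standard -> /remote_standard ->. Qed.

End standard_semimetric.

Definition standard_semimetric (R : realType) : semimetric R (circle R) :=
  Semimetric (@standard_dist_sym R) (@standard_dist_diag R)
    (@standard_dist_gt0 R) (@standard_dist_infty R) (@standard_remote_uniq R).

Definition canonical_mobius (R : realType) : mobius_structure R (circle R) :=
  MobiusStructure (ex_intro _ (standard_semimetric R) erefl).

Definition convexity_axiom (R : realType) (M : mobius_structure R (circle R))
    : Prop :=
  forall (o' x y z o w : circle R) (d : semimetric R (circle R)),
    representatives M d ->
    uniq [:: o'; x; y; z; o; w] ->
    cyclically_ordered [:: o'; x; y; z; o; w] ->
    (dfactor d o' x * dfactor d y o) / (dfactor d x o * dfactor d o' y)
      = (dfactor d o' y * dfactor d z o) / (dfactor d y o * dfactor d o' z) ->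
    (dfactor d y o * dfactor d z w) / (dfactor d y w * dfactor d z o)
      > (dfactor d x o * dfactor d y w) / (dfactor d x w * dfactor d y o).

(* Main.v *)
(** In homogeneous coordinates every distance occurring in a cross-ratio for
    the standard metric is the absolute value of a 2x2 determinant, and the
    coordinates of cyclically ordered points can be chosen so that all the
    determinants [p q], with p before q, are positive. Sending o to infinity,
    put f(p) = [o' p] / [p o] for p among x, y, z. The hypothesis
    says that f(y) is the geometric mean of f(x) < f(y) < f(z), while Plücker's
    relation gives [p w] / [p o] = t + s f(p) with s, t > 0. By the strict
    AM-GM inequality f(x) + f(z) > 2 f(y), hence
    (t + s f(x)) (t + s f(z)) > (t + s f(y))^2, which is the conclusion. *)
Require Import Defs.
From mathcomp Require Import all_boot all_order all_algebra.
From mathcomp Require Import all_classical all_reals all_analysis.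
From mathcomp Require Import ring lra.
Import Order.TTheory GRing.Theory Num.Theory.

Set Implicit Arguments.
Unset Strict Implicit.
Unset Printing Implicit Defensive.

Local Open Scope ring_scope.

Lemma pairwise_rev (T : Type) (r : rel T) (s : seq T) :
  pairwise r (rev s) = pairwise (fun x y => r y x) s.
Proof.
elim: s => //= x s IHs; rewrite rev_cons -cats1 pairwise_cat /= IHs andbT.
by rewrite allrel1r all_rev.
Qed.

Lemma dfactor_sym (R : realType) (X : eqType) (d : semimetric R X) (x y : X) :
  dfactor d x y = dfactor d y x.
Proof. by rewrite /dfactor semidist_sym. Qed.

(** Up to symmetry of the distance, the ratios in the convexity axiom are cross-ratios; this is
    their invariance in the shape needed there. *)
Lemma mobius_equivalentP (R : realType) (X : eqType) (d d' : semimetric R X)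
    (p q x y : X) : mobius_equivalent d d' -> uniq [:: p; q; x; y] ->
  (dfactor d' p x * dfactor d' y q) / (dfactor d' x q * dfactor d' p y) =
  (dfactor d p x * dfactor d y q) / (dfactor d x q * dfactor d p y).
Proof.
move=> dd' /dd'; rewrite /cross_ratio !(dfactor_sym _ q) => E.
by rewrite ![dfactor _ x q * _]mulrC E.
Qed.

(* The sign makes [det (a, 1) (b, 1) = b - a] positive for a < b. *)
Definition det (R : pzRingType) (u v : R * R) : R := u.2 * v.1 - u.1 * v.2.

Section determinant.
Variable R : realType.
Implicit Types (p q : circle R) (s : seq (circle R)).

(** With (1, 0) for the point at infinity, its determinant with a finite point is 1 or -1, matching
    the factor 1 that [dfactor] assigns to an infinite distance. *)
Definition homogeneous p : R * R := if p is Some a then (a, 1) else (1, 0).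

Lemma dfactor_standard p q : p != q ->
  dfactor (standard_semimetric R) p q = `|det (homogeneous p) (homogeneous q)|.
Proof.
case: p q => [a|] [b|] //= _; rewrite /dfactor /det /=.
- by rewrite mul1r mulr1 distrC.
- by rewrite mul1r mulr0 subr0 normr1.
- by rewrite mul0r mul1r sub0r normrN normr1.
Qed.

Lemma det_homogeneous_gt0 p q :
  (circle_coord p < circle_coord q)%E -> 0 < det (homogeneous p) (homogeneous q).
Proof.
case: p q => [a|] [b|] //=; rewrite /det /= ?mul1r ?mulr0 ?mulr1.
- by rewrite lte_fin subr_gt0.
- by rewrite subr0 ltr01.
Qed.

Definition lifts (h : circle R -> R * R) : Prop :=
  forall p q, p != q ->
  dfactor (standard_semimetric R) p q = `|det (h p) (h q)|.

Definition det_positive (h : circle R -> R * R) s : bool :=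
  pairwise (fun p q => 0 < det (h p) (h q)) s.

(** In the sorted rotation [drop k s] precedes [take k s], so in the coordinates [homogeneous] only
    determinants between these two blocks have the wrong sign; negating the vectors of one block
    corrects exactly these. *)
Lemma positively_ordered_lift s : positively_ordered s ->
  exists2 h, lifts h & det_positive h s.
Proof.
case=> k; rewrite -map_rot lt_sorted_pairwise pairwise_map => hs.
have us : uniq (rot k s).
  apply: pairwise_uniq hs => p /=; exact: ltxx.
have dtd : {in take k s, forall p, p \notin drop k s}.
  move: us; rewrite /rot cat_uniq => /and3P[_ /hasPn nd _] p.
  exact: nd.
move: hs; rewrite /rot pairwise_cat => /and3P[/allrelP across hd ht].
(* Crossing the cut of the rotation reverses the sign of the determinant. *)
exists (fun p => let u := homogeneous p in
         if p \in drop k s then (- u.1, - u.2) else u).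
- move=> p q pq; rewrite dfactor_standard// /det.
  case: ifP => _; case: ifP => _ //=; rewrite ?mulNr ?mulrN ?opprK//.
    by rewrite -normrN opprB addrC.
  by rewrite -normrN opprB addrC.
- rewrite -[s in det_positive _ s](cat_take_drop k) /det_positive pairwise_cat.
  apply/and3P; split.
  + apply/allrelP => p q pt qd; rewrite (negbTE (dtd _ pt)) qd /=.
    have := det_homogeneous_gt0 (across _ _ qd pt).
    by rewrite /det /=; lra.
  + apply: (sub_in_pairwise (P := mem (take k s))) ht; last exact/allP.
    move=> p q pt qt /det_homogeneous_gt0.
    by rewrite (negbTE (dtd _ pt)) (negbTE (dtd _ qt)).
  + apply: (sub_in_pairwise (P := mem (drop k s))) hd; last exact/allP.
    move=> p q pd qd /det_homogeneous_gt0.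
    have -> : p \in drop k s by [].
    have -> : q \in drop k s by [].
    by rewrite /det /=; lra.
Qed.

Lemma cyclically_ordered_lift s : cyclically_ordered s ->
  exists2 h, lifts h & det_positive h s.
Proof.
case=> [/positively_ordered_lift//|/positively_ordered_lift[h hh hs]].
(* A reflection negates every determinant, which undoes the reversal of the order. *)
exists (fun p => (- (h p).1, (h p).2)).
- by move=> p q /hh ->; rewrite /det /= mulrN mulNr opprK -normrN opprB addrC.
- move: hs; rewrite /det_positive pairwise_rev; apply: sub_pairwise => p q /=.
  by rewrite /det /=; lra.
Qed.

End determinant.

Lemma convex_geometric_mean (R : realFieldType) (s t x y z : R) :
  0 < s -> 0 < t -> 0 < x -> x < y -> 0 < z -> y ^+ 2 = x * z ->
  (t + s * y) ^+ 2 < (t + s * x) * (t + s * z).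
Proof.
move=> s0 t0 x0 xy z0 yxz.
(* Strict AM-GM without square roots: as [y ^+ 2 = x * z], this product is [(y - x) ^+ 2]. *)
have : 0 < x * (x + z - 2 * y).
  have -> : x * (x + z - 2 * y) = (y - x) ^+ 2 by rewrite mulrDr mulrDr -yxz; ring.
  by rewrite exprn_gt0// subr_gt0.
rewrite pmulr_rgt0// => amgm; rewrite -subr_gt0.
have -> : (t + s * x) * (t + s * z) - (t + s * y) ^+ 2 =
          t * s * (x + z - 2 * y) + s ^+ 2 * (x * z - y ^+ 2) by ring.
by rewrite yxz subrr mulr0 addr0 !mulr_gt0.
Qed.

Lemma det_convexity (R : realFieldType) (o' x y z o w : R * R) :
  0 < det o' x -> 0 < det o' z -> 0 < det o' o -> 0 < det o' w ->
  0 < det x y -> 0 < det x o -> 0 < det x w -> 0 < det y o -> 0 < det y w ->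
  0 < det z o -> 0 < det o w -> 0 < det o' y ->
  (det o' x * det y o) / (det x o * det o' y)
    = (det o' y * det z o) / (det y o * det o' z) ->
  (det x o * det y w) / (det x w * det y o)
    < (det y o * det z w) / (det y w * det z o).
Proof.
move=> o'x o'z o'o o'w xy xo xw yo yw zo ow o'y /eqP.
(* [f] is the projective coordinate that is 0 at [o'] and infinite at [o]. *)
pose f p := det o' p / det p o.
pose t := det o' w / det o' o; pose s := det o w / det o' o.
have plucker p : det p o != 0 -> det p w = (t + s * f p) * det p o.
  move=> po; apply: (mulIf (lt0r_neq0 o'o)).
  transitivity (det o' w * det p o + det o w * det o' p).
    by rewrite /det; ring.
  by rewrite /t /s /f; field; rewrite po lt0r_neq0.
rewrite eqr_div ?mulf_neq0 ?lt0r_neq0// => /eqP E.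
(* Plücker's relation for [o'], [x], [y], [o], with denominators cleared. *)
have fxy : f x < f y.
  rewrite ltr_pdivrMr// mulrAC ltr_pdivlMr// -subr_gt0.
  have -> : det o' y * det x o - det o' x * det y o = det o' o * det x y.
    by rewrite /det; ring.
  exact: mulr_gt0.
have fyxz : f y ^+ 2 = f x * f z.
  apply/eqP; rewrite expr_div_n mulf_div eqr_div ?mulf_neq0 ?expf_neq0 ?lt0r_neq0//.
  have -> : det o' x * det o' z * det y o ^+ 2 =
            det o' x * det y o * (det y o * det o' z) by ring.
  by rewrite E; apply/eqP; ring.
have s0 : 0 < s by exact: divr_gt0.
have t0 : 0 < t by exact: divr_gt0.
have fx0 : 0 < f x by exact: divr_gt0.
have fz0 : 0 < f z by exact: divr_gt0.
have := convex_geometric_mean s0 t0 fx0 fxy fz0 fyxz.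
have X0 : 0 < t + s * f x by apply: addr_gt0 => //; exact: mulr_gt0.
have Y0 : 0 < t + s * f y by apply: addr_gt0 => //; apply: mulr_gt0 => //; exact: lt_trans fxy.
(* The factors [det _ o] cancel, leaving quotients of values of [t + s * f _]. *)
rewrite !plucker ?lt0r_neq0//.
have -> : det x o * ((t + s * f y) * det y o) /
    ((t + s * f x) * det x o * det y o) = (t + s * f y) / (t + s * f x).
  by field; rewrite !lt0r_neq0.
have -> : det y o * ((t + s * f z) * det z o) /
    ((t + s * f y) * det y o * det z o) = (t + s * f z) / (t + s * f y).
  by field; rewrite !lt0r_neq0.
by move=> gm; rewrite ltr_pdivrMr// [ltRHS]mulrAC ltr_pdivlMr// -expr2 [X in _ < X]mulrC.
Qed.

Theorem proposition7p15 (R : realType) : convexity_axiom (canonical_mobius R).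
Proof.
move=> o' x y z o w d dM _ /cyclically_ordered_lift[h hh].
rewrite /det_positive /= !andbT => /and5P[].
move=> /and5P[ o'x o'y o'z o'o o'w] /and4P[xy xz xo xw] /and3P[yz yo yw].
move=> /andP[zo zw] ow.
have ne p q : 0 < det (h p) (h q) -> p != q.
  by apply: contraTneq => ->; rewrite /det mulrC subrr ltxx.
have abs p q (pq : 0 < det (h p) (h q)) :
    dfactor (standard_semimetric R) p q = det (h p) (h q).
  by rewrite hh ?gtr0_norm// ne.
(* The hypothesis compares two cross-ratios containing [o'] and [o], the conclusion two containing
   [o] and [w]; all four pass from [d] to the standard semi-metric. *)
have u1 : uniq [:: o'; o; x; y].
  by rewrite /= !inE !negb_or !(eq_sym o) !ne.
have u2 : uniq [:: o'; o; y; z].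
  by rewrite /= !inE !negb_or !(eq_sym o) !ne.
have u3 : uniq [:: o; w; x; y].
  by rewrite /= !inE !negb_or !(eq_sym w) !(eq_sym o) (eq_sym w o) !ne.
have u4 : uniq [:: o; w; y; z].
  by rewrite /= !inE !negb_or !(eq_sym w) !(eq_sym o) (eq_sym w o) !ne.
rewrite (mobius_equivalentP dM u1) (mobius_equivalentP dM u2).
rewrite (dfactor_sym d y o) (dfactor_sym d z o) (dfactor_sym d x o).
rewrite (mobius_equivalentP dM u3) (mobius_equivalentP dM u4).
rewrite !(dfactor_sym _ o) !abs//.
exact: det_convexity.
Qed.
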